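(* Let $G$ be a finite connected graph with positive edge lengths whose shortest-path metric $d_G$ satisfies $d_G(u,v)=$ length of $uv$ for every edge $uv$, and let $E(G)$ be its edge set with some orientation. Let $\mathcal M=\bigsqcup_{k=0}^{n'}\mathcal M_k$ be a finite index set and $\{\mu_t\}_{t\in\mathcal M}\subseteq\mathrm{TC}(V(G))$. Suppose: (C1) there are $C<\infty$ and $th:E(G)\to(0,\infty)$ with $\sum_{uv\in E(G)}th(uv)d_G(u,v)=1$ such that every $f:V(G)\to\mathbb{R}$ satisfies $$\sum_{k=0}^{n'}\Big(\sum_{t\in\mathcal M_k}\Big|\int f\,d\mu_t\Big|^2\Big)^{1/2}\le C\sum_{uv\in E(G)}|f(u)-f(v)|\,th(uv);$$ (C2) for each $k\in\{0,\dots,n'\}$ there are $\alpha_k\ge0$ and a family $\{\theta_i:\mathcal M_k\to\mathbb{R}\}_{i\in\mathcal M_k}$ of pairwise orthogonal functions (in $\ell_2(\mathcal M_k)$) with $|\theta_i(t)|\le1$ for all $i,t\in\mathcal M_k$ and $\min_{i\in\mathcal M_k}\big\|\sum_{t\in\mathcal M_k}\theta_i(t)\mu_t\big\|_{\mathrm{TC}}\ge\alpha_k$. Then $c_1(\mathrm{TC}(V(G)))\ge C^{-1}\sum_{k=0}^{n'}\alpha_k$.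
   Context: For a finite metric space $(X,d)$, $\mathrm{TC}(X)$ is the space of signed measures $\mu$ on $X$ with $\mu(X)=0$, normed by $\|\mu\|_{\mathrm{TC}}=\inf\sum_i a_id(x_i,y_i)$ over all representations $\mu=\sum_i a_i(\delta_{x_i}-\delta_{y_i})$ with $a_i\ge0$. For a metric space $Y$, $c_1(Y)$ is the infimal $D\ge1$ such that some map $F:Y\to L_1(M)$ (some measure space) satisfies $\rho(x,y)\le\|F(x)-F(y)\|_1\le D\rho(x,y)$. Here $V(G)$ carries the metric $d_G$. *)

(* Defs.v *)
From HB Require Import structures.
From mathcomp Require Import all_boot all_order all_algebra.
From mathcomp Require Import all_classical all_reals all_analysis.
Set Implicit Arguments. Unset Strict Implicit. Unset Printing Implicit Defensive.
Import Order.TTheory GRing.Theory Num.Theory.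
Local Open Scope ring_scope.
Local Open Scope classical_set_scope.

Definition dirac_diff (R : realType) (V : finType) (x y : V) : V -> R :=
  fun v => (v == x)%:R - (v == y)%:R.

Definition is_TC (R : realType) (V : finType) (mu : V -> R) : Prop :=
  \sum_(v : V) mu v = 0.

Definition TC_costs (R : realType) (V : finType) (d : V -> V -> R) (mu : V -> R) : set R :=
  [set c | exists s : seq (R * V * V),
      all (fun p => 0 <= p.1.1) s /\
      mu = (fun v => \sum_(p <- s) p.1.1 * dirac_diff R p.1.2 p.2 v) /\
      c = \sum_(p <- s) p.1.1 * d p.1.2 p.2].

Definition tc_norm (R : realType) (V : finType) (d : V -> V -> R) (mu : V -> R) : R :=
  inf (TC_costs d mu).

Definition tc_dist (R : realType) (V : finType) (d : V -> V -> R) (x y : V -> R) : R :=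
  tc_norm d (fun v => x v - y v).

(* There is a measure space (T, m) and F : Y -> L_1(m) with
   rho(x,y) <= ||F x - F y||_1 <= D rho(x,y) on the subset Y = P of X.
   Elements of L_1 are represented by integrable functions (the L_1 norm
   does not depend on the representative). *)
Definition L1_embeds_with (R : realType) (X : Type) (P : set X) (rho : X -> X -> R) (D : R) : Prop :=
  exists (d : measure_display) (T : measurableType d) (m : {measure set T -> \bar R})
         (F : X -> T -> R),
    (forall x, P x -> m.-integrable setT (EFin \o F x)) /\
    (forall x y, P x -> P y ->
       ((rho x y)%:E <= \int[m]_(t in setT) (`|F x t - F y t|)%:E)%E /\
       (\int[m]_(t in setT) (`|F x t - F y t|)%:E <= (D * rho x y)%:E)%E).

(* c_1(Y) = inf { D >= 1 | some such F exists }  (in \bar R; +oo if none) *)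
Definition c1 (R : realType) (X : Type) (P : set X) (rho : X -> X -> R) : \bar R :=
  ereal_inf [set D%:E | D in [set D : R | 1 <= D /\ L1_embeds_with P rho D]].

(* A finite graph on V is given by an oriented edge set E : {set V * V}
   (each edge uv appears in exactly one orientation), with lengths len : V*V -> R. *)

Definition adj (V : finType) (E : {set V * V}) : rel V :=
  fun u v => ((u, v) \in E) || ((v, u) \in E).

Definition elen (R : realType) (V : finType) (E : {set V * V}) (len : V * V -> R) (u v : V) : R :=
  if (u, v) \in E then len (u, v) else len (v, u).

Definition path_len (R : realType) (V : finType) (E : {set V * V}) (len : V * V -> R)
    (u : V) (p : seq V) : R :=
  \sum_(q <- zip (u :: p) p) elen E len q.1 q.2.

Definition dG (R : realType) (V : finType) (E : {set V * V}) (len : V * V -> R) (u v : V) : R :=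
  inf [set L | exists p : seq V, path (adj E) u p /\ last u p = v /\ L = path_len E len u p].

(* Main.v *)
Require Import Defs.
From HB Require Import structures.
From mathcomp Require Import all_boot all_order all_algebra.
From mathcomp Require Import all_classical all_reals all_analysis.
From mathcomp Require Import ring lra.
Import Order.TTheory GRing.Theory Num.Theory.
Local Open Scope ring_scope.
Local Open Scope classical_set_scope.

(** If [F] were linear, (C1) could be applied for each point [om] of the measure
    space to [f v := F (delta_v) om] and integrated: the right-hand side is at
    most [C * D], while Bessel's inequality for the [theta_i] bounds the left-hand
    side below by the sums over [k] of the averages over [i] of the norms of
    [F (\sum_t theta_i t * mu_t)], hence by [\sum_k alpha_k].

    A nonlinear [F] is first averaged over a large lattice box of translations.
    The average [G] has the same Lipschitz bounds, and its second differences are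
    small, so [G] is nearly affine at a large scale [K].  It stays at bounded
    distance from [F], so along a long segment in a direction [nu] the total
    variation of [G] is almost at least the length of the segment; averaging over
    long segments in all the (finitely many) directions [nu] of interest gives a
    base point where the linear part of [G] is almost noncontracting on all of
    them on average.  The linear argument applies there.  Only finite averages in
    [x] occur, since [F x om] need not be measurable in [x]. *)

Lemma subr_split (Z : zmodType) (a b c d g : Z) :
  a - b - (c + d) = (g - b - c) + (a - g - d).
Proof. by rewrite [RHS]addrACA [X in _ = X + _]addrC subrKA opprD. Qed.

Lemma subrACA (Z : zmodType) (p q r t : Z) : p - q - (r - t) = p - r - (q - t).
Proof. by rewrite !opprD !opprK addrACA. Qed.

(** * Averages over boxes of translations *)

Section ShiftAverage.
Context {R : realType} {W : lmodType R}.
Implicit Types (l : seq W) (x y w : W) (J : nat).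

(** The mean over the box of points [x + \sum_w j_w *: w] with [0 <= j_w < J], nested with one
    average per entry of the list so that each direction can be treated by induction. *)
Fixpoint shift_avg {B : lmodType R} J l (f : W -> B) x : B :=
  if l is w :: l' then
    J%:R^-1 *: \sum_(j < J) shift_avg J l' f (x + j%:R *: w)
  else f x.

Lemma shift_avg_translate (B : lmodType R) J l (f : W -> B) y x :
  shift_avg J l (fun z => f (z + y)) x = shift_avg J l f (x + y).
Proof.
elim: l x => [//|w l IH] x /=; congr (_ *: _).
by apply: eq_bigr => j _; rewrite IH addrAC.
Qed.

Lemma shift_avgB (B : lmodType R) J l (f g : W -> B) x :
  shift_avg J l (fun z => f z - g z) x = shift_avg J l f x - shift_avg J l g x.
Proof.
elim: l x => [//|w l IH] x /=; rewrite -scalerBr -sumrB; congr (_ *: _).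
by apply: eq_bigr => j _; rewrite IH.
Qed.

Lemma shift_avgZ (B : lmodType R) J l (c : R) (f : W -> B) x :
  shift_avg J l (fun z => c *: f z) x = c *: shift_avg J l f x.
Proof.
elim: l x => [//|w l IH] x /=; rewrite scalerA mulrC -scalerA; congr (_ *: _).
by rewrite scaler_sumr; apply: eq_bigr => j _; rewrite IH.
Qed.

Lemma shift_avg_sum (B : lmodType R) J l (I : Type) (r : seq I) (f : I -> W -> B) x :
  shift_avg J l (fun z => \sum_(i <- r) f i z) x =
  \sum_(i <- r) shift_avg J l (f i) x.
Proof.
elim: l x => [//|w l IH] x /=; rewrite -scaler_sumr exchange_big/=.
by congr (_ *: _); apply: eq_bigr => j _; rewrite IH.
Qed.

Lemma shift_avg_ge J l (f : W -> R^o) (c : R) x : (0 < J)%N ->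
  (forall z, c <= f z) -> c <= shift_avg J l f x.
Proof.
move=> J0 cf; elim: l x => [//|w l IH] x /=.
rewrite /GRing.scale/= ler_pdivlMl ?ltr0n// mulr_natl.
have -> : c *+ J = \sum_(j < J) c by rewrite sumr_const card_ord.
by apply: ler_sum.
Qed.

(** Averages in different directions commute, so the one along [w] can be taken innermost, where the
    hypothesis bounds it at every base point. *)
Lemma shift_avg_mem_ge J l w (f : W -> R^o) (c : R) x : (0 < J)%N -> w \in l ->
  (forall z, c *+ J <= \sum_(j < J) f (z + j%:R *: w)) -> c <= shift_avg J l f x.
Proof.
move=> J0 + cf; elim: l x => [//|u l IH] x /=; rewrite in_cons => /predU1P[<-|wl].
  have -> : J%:R^-1 *: (\sum_(j < J) shift_avg J l f (x + j%:R *: w)) =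
     shift_avg J l (fun z => J%:R^-1 *: \sum_(j < J) f (z + j%:R *: w)) x.
    rewrite shift_avgZ shift_avg_sum; congr (_ *: _).
    by apply: eq_bigr => j _; rewrite shift_avg_translate.
  apply: shift_avg_ge => // z.
  by rewrite /GRing.scale/= ler_pdivlMl ?ltr0n// mulr_natl.
apply: (shift_avg_ge _ [:: u] (shift_avg J l f)) => // z.
exact: IH.
Qed.

(** * Seminorm estimates for averages *)

Section Seminorm.
Context {B : lmodType R} {N : B -> R}.
Hypothesis ND : forall a b, N (a + b) <= N a + N b.
Hypothesis NZ : forall (c : R) a, N (c *: a) = `|c| * N a.

Lemma seminorm0 : N 0 = 0.
Proof. by rewrite -(scale0r 0) NZ normr0 mul0r. Qed.

Lemma seminormN a : N (- a) = N a.
Proof. by rewrite -scaleN1r NZ normrN1 mul1r. Qed.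

Lemma seminorm_ge0 a : 0 <= N a.
Proof.
have := ND a (- a); rewrite subrr seminorm0 seminormN -mulr2n.
by rewrite pmulrn_lge0.
Qed.

Lemma seminormB a b : N (a - b) <= N a + N b.
Proof. by rewrite -(seminormN b). Qed.

Lemma seminormC a b : N (a - b) = N (b - a).
Proof. by rewrite -seminormN opprB. Qed.

Lemma seminorm_sum (I : Type) (r : seq I) (P : pred I) (f : I -> B) :
  N (\sum_(i <- r | P i) f i) <= \sum_(i <- r | P i) N (f i).
Proof.
apply: (big_ind2 (fun a b => N a <= b)) => //; first by rewrite seminorm0.
by move=> a a' b b' h h'; rewrite (le_trans (ND _ _))// lerD.
Qed.

Lemma seminorm_avg J (f : nat -> B) (b : R) : (0 < J)%N ->
  (forall j, (j < J)%N -> N (f j) <= b) ->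
  N (J%:R^-1 *: \sum_(j < J) f j) <= b.
Proof.
move=> J0 fb; rewrite NZ ger0_norm ?invr_ge0 ?ler0n// ler_pdivrMl ?ltr0n//.
rewrite mulr_natl (le_trans (seminorm_sum _ _ _ _))//.
have -> : b *+ J = \sum_(j < J) b by rewrite sumr_const card_ord.
by apply: ler_sum => j _; apply: fb.
Qed.

Lemma seminorm_shift_avg J l (f : W -> B) (b : R) x : (0 < J)%N ->
  (forall z, N (f z) <= b) -> N (shift_avg J l f x) <= b.
Proof.
move=> J0 fb; elim: l x => [//|w l IH] x /=.
exact: (seminorm_avg _ (fun j => shift_avg J l f (x + j%:R *: w))).
Qed.

Lemma shift_avg_Lipschitz J l (f : W -> B) y z (b : R) x : (0 < J)%N ->
  (forall x, N (f (x + y) - f (x + z)) <= b) ->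
  N (shift_avg J l f (x + y) - shift_avg J l f (x + z)) <= b.
Proof.
move=> J0 fb; rewrite -!shift_avg_translate -shift_avgB.
exact: seminorm_shift_avg.
Qed.

(* The sum over [j < J] telescopes, so shifting by one of the averaging
   directions gains a factor [J]. *)
Lemma shift_avg_diff_small J l w (f : W -> B) (b : R) x : (0 < J)%N ->
  w \in l -> (forall z, N (f z) <= b) ->
  N (shift_avg J l f (x + w) - shift_avg J l f x) <= 2 * b / J%:R.
Proof.
move=> J0 + fb; elim: l x => [//|u l IH] x /=; rewrite in_cons => /predU1P[<-|wl].
  rewrite -scalerBr -sumrB.
  have -> : \sum_(j < J) (shift_avg J l f (x + w + j%:R *: w) -
      shift_avg J l f (x + j%:R *: w)) =
      shift_avg J l f (x + J%:R *: w) - shift_avg J l f x.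
    rewrite -(big_mkord xpredT (fun j => shift_avg J l f (x + w + j%:R *: w) -
      shift_avg J l f (x + j%:R *: w))).
    under eq_bigr do rewrite -addrA -{1}[w]scale1r -scalerDl nat1r.
    by rewrite (telescope_sumr (fun j => shift_avg J l f (x + j%:R *: w)))//
      scale0r addr0.
  rewrite NZ ger0_norm ?invr_ge0 ?ler0n// mulrC ler_wpM2r ?invr_ge0 ?ler0n//.
  rewrite (le_trans (seminormB _ _))// mulr2n mulrDl mul1r.
  by apply: lerD; apply: seminorm_shift_avg.
rewrite -scalerBr -sumrB.
apply: (seminorm_avg _ (fun j => shift_avg J l f (x + w + j%:R *: u) -
      shift_avg J l f (x + j%:R *: u))) => // j _.
by rewrite addrAC; apply: IH.
Qed.

(** Each direction displaces the argument by fewer than [J] steps, which costs at most [L * J]. *)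
Lemma shift_avg_dist J l (f : W -> B) (L : R) x : (0 < J)%N -> 0 <= L ->
  (forall z w (r : R), w \in l -> N (f (z + r *: w) - f z) <= L * `|r|) ->
  N (shift_avg J l f x - f x) <= L * J%:R *+ size l.
Proof.
move=> J0 L0; elim: l x => [|w l IH] x fL /=; first by rewrite subrr seminorm0 mulr0n.
have -> : f x = J%:R^-1 *: \sum_(j < J) f x.
  by rewrite sumr_const card_ord -(scaler_nat J (f x)) scalerA mulVf ?scale1r// pnatr_eq0 -lt0n.
rewrite -scalerBr -sumrB.
apply: (seminorm_avg _ (fun j => shift_avg J l f (x + j%:R *: w) - f x)) => // j jJ.
rewrite -(subrK (f (x + j%:R *: w)) (shift_avg _ _ _ _)) -addrA (le_trans (ND _ _))//.
rewrite mulrS [leRHS]addrC lerD//; last first.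
  rewrite (le_trans (fL _ _ _ (mem_head _ _)))// ler_wpM2l//.
  by rewrite ger0_norm ?ler0n// ler_nat ltnW.
by apply: IH => z u r ul; apply: fL; rewrite in_cons ul orbT.
Qed.

Definition fwd_diff (G : W -> B) w x := G (x + w) - G x.

(** * Affine approximation from small second differences *)

Section Linearization.
Context {V : finType} {e : V -> W} {G : W -> B} {L eta : R}.
Hypothesis L0 : 0 <= L.
Hypothesis eta0 : 0 <= eta.
Hypothesis GL : forall x v (r : R), N (G (x + r *: e v) - G x) <= L * `|r|.

Hypothesis dGL : forall x v u (r : R),
  N (fwd_diff G (e v) (x + r *: e u) - fwd_diff G (e v) x) <= eta * `|r|.

(** The [j]-th unit increment differs from the first by at most [eta * j]; summing over [j < n]
    stays below [eta * n ^ 2]. *)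
Lemma linear_approx_nat x v n :
  N (G (x + n%:R *: e v) - G x - n%:R *: fwd_diff G (e v) x) <= eta * n%:R ^+ 2.
Proof.
elim: n => [|n IH].
  by rewrite !scale0r addr0 !subrr seminorm0 expr0n/= mulr0.
have -> : G (x + n.+1%:R *: e v) - G x - n.+1%:R *: fwd_diff G (e v) x =
  (G (x + n%:R *: e v) - G x - n%:R *: fwd_diff G (e v) x) +
  (fwd_diff G (e v) (x + n%:R *: e v) - fwd_diff G (e v) x).
  rewrite -natr1 !scalerDl !scale1r (subr_split _ _ _ _ _ (G (x + n%:R *: e v))).
  by rewrite [fwd_diff G (e v) (_ + _)]/fwd_diff -(addrA x).
rewrite (le_trans (ND _ _))// (le_trans (lerD IH (dGL _ _ _ _)))//.
rewrite ger0_norm ?ler0n// -mulrDr ler_wpM2l// -natr1.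
have := ler0n R n; nra.
Qed.

(** For [r >= 0] the integer part is the previous lemma, and the fractional part costs [L] for the
    increment of [G] and [L] for its linear term. For [r < 0] the segment is read from its other
    endpoint; moving the difference back to [x] costs a further [eta * r ^ 2], hence the factor
    2. *)
Lemma linear_approx1 x v (r : R) :
  N (G (x + r *: e v) - G x - r *: fwd_diff G (e v) x) <= 2 * L + 2 * eta * r ^+ 2.
Proof.
have pos y (q : R) : 0 <= q ->
    N (G (y + q *: e v) - G y - q *: fwd_diff G (e v) y) <= 2 * L + eta * q ^+ 2.
  move=> q0; have /andP[nq qn] := truncn_itv q0.
  set n := Num.truncn q in nq qn.
  have qE : q *: e v = n%:R *: e v + (q - n%:R) *: e v.
    by rewrite -scalerDl addrC subrK.
  have -> : G (y + q *: e v) - G y - q *: fwd_diff G (e v) y =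
     (G (y + n%:R *: e v) - G y - n%:R *: fwd_diff G (e v) y) +
     ((G (y + n%:R *: e v + (q - n%:R) *: e v) - G (y + n%:R *: e v)) -
      (q - n%:R) *: fwd_diff G (e v) y).
    by rewrite qE addrA -subr_split -scalerDl [n%:R + _]addrC subrK.
  rewrite (le_trans (ND _ _))// addrC lerD//; last first.
    rewrite (le_trans (linear_approx_nat _ _ _))// ler_wpM2l//.
    by rewrite ler_sqr ?nnegrE ?ler0n.
  have qn0 : 0 <= q - n%:R by rewrite subr_ge0.
  have qn1 : q - n%:R <= 1 by rewrite lerBlDl natr1 ltW.
  rewrite (le_trans (seminormB _ _))// mulr2n mulrDl mul1r lerD//.
    by rewrite (le_trans (GL _ _ _))// ger0_norm// ler_piMr.
  rewrite NZ ger0_norm//.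
  have := GL y v 1; rewrite scale1r normr1 mulr1 -/(fwd_diff G (e v) y) => h.
  rewrite (le_trans (ler_wpM2l qn0 h))//.
  by rewrite ler_piMl.
have [r0|r0] := leP 0 r.
  rewrite (le_trans (pos _ _ r0))//; have := mulr_ge0 eta0 (sqr_ge0 r); lra.
have r0' : 0 <= - r by lra.
set y := x + r *: e v.
have xE : x = y + (- r) *: e v by rewrite /y scaleNr addrK.
have -> : G y - G x - r *: fwd_diff G (e v) x =
  (- r) *: (fwd_diff G (e v) (y + (- r) *: e v) - fwd_diff G (e v) y) -
  (G (y + (- r) *: e v) - G y - (- r) *: fwd_diff G (e v) y).
  rewrite -xE !scaleNr scalerBr !opprD !opprK [RHS]addrC [- (_ *: _) + _]addrC.
  by rewrite subrKA [- G x + _]addrC.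
rewrite (le_trans (seminormB _ _))// NZ.
have := ler_wpM2l (normr_ge0 (- r)) (dGL y v v (- r)); have := pos y _ r0'.
rewrite !normrN ltr0_norm//; lra.
Qed.

(** One coordinate is moved at a time. After each move the differences in the remaining directions
    are taken at a new base point, and returning each of them to the old one costs at most
    [eta * M ^ 2]. *)
Lemma linear_approx (s : seq V) (c : V -> R) (M : R) x : 0 <= M ->
  (forall v, `|c v| <= M) ->
  N (G (x + \sum_(v <- s) c v *: e v) - G x - \sum_(v <- s) c v *: fwd_diff G (e v) x) <=
  2 * L * (size s)%:R + eta * M ^+ 2 * ((size s)%:R ^+ 2 + 2 * (size s)%:R).
Proof.
move=> M0 cM; elim: s x => [|v s IH] x.
  by rewrite !big_nil addr0 !subrr seminorm0/= mulr0 expr0n/= mulr0 !addr0 mulr0.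
rewrite !big_cons addrA; set y := x + c v *: e v.
have -> : G (y + \sum_(j <- s) c j *: e j) - G x -
    (c v *: fwd_diff G (e v) x + \sum_(j <- s) c j *: fwd_diff G (e j) x) =
  (G (y + \sum_(j <- s) c j *: e j) - G y - \sum_(j <- s) c j *: fwd_diff G (e j) y) +
  ((G y - G x - c v *: fwd_diff G (e v) x) +
   \sum_(j <- s) c j *: (fwd_diff G (e j) y - fwd_diff G (e j) x)).
  under [X in _ = _ + (_ + X)]eq_bigr do rewrite scalerBr.
  by rewrite sumrB addrCA subrKA -subr_split.
rewrite (le_trans (ND _ _))// (le_trans (lerD (IH _) (ND _ _)))//.
have h2 : N (\sum_(j <- s) c j *: (fwd_diff G (e j) y - fwd_diff G (e j) x)) <=
   (size s)%:R * (eta * M ^+ 2).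
  rewrite (le_trans (seminorm_sum _ _ _ _))//.
  have -> : (size s)%:R * (eta * M ^+ 2) = \sum_(j <- s) (eta * M ^+ 2).
    by rewrite big_const_seq count_predT iter_addr_0 mulr_natl.
  apply: ler_sum => j _; rewrite NZ expr2 mulrCA ler_pM ?seminorm_ge0//.
  by rewrite (le_trans (dGL _ _ _ _))// ler_wpM2l.
have h1 : 2 * L + 2 * eta * c v ^+ 2 <= 2 * L + 2 * eta * M ^+ 2.
  rewrite lerD2l ler_wpM2l ?mulr_ge0// -real_normK ?num_real//.
  by rewrite ler_sqr ?nnegrE.
have := linear_approx1 x v (c v); rewrite -/y => h3.
rewrite (le_trans (lerD (lexx _) (lerD (le_trans h3 h1) h2)))//= -natr1.
have M2 : 0 <= eta * M ^+ 2 by rewrite mulr_ge0 ?sqr_ge0.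
have := ler0n R (size s); nra.
Qed.

End Linearization.
End Seminorm.
End ShiftAverage.

(** * Linearization of a nonlinear map at a large scale *)

Lemma exists_nat_mul_ge (R : realType) (b eps : R) : 0 < eps ->
  exists n, (0 < n)%N /\ b <= eps * n%:R.
Proof.
move=> eps0; exists (Num.truncn (`|b| / eps)).+1; split => //.
rewrite mulrC -ler_pdivrMr// (le_trans _ (ltW (truncnS_gt _)))//.
by rewrite ler_wpM2r ?ler_norm// invr_ge0 ltW.
Qed.

(** The second clause replaces the choice of a good base point: a bound [b] valid at every [x] also
    holds for a mean over many base points, and some such mean is at least
    [\sum_i w i * (a i - eps)]. *)
Lemma asymptotic_linearization {R : realType} {W B : lmodType R} {N : B -> R}
    (V I : finType) (e : V -> W) (F : W -> B) (L : R)
    (c : I -> V -> R) (a : I -> R) (eps : R) :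
  (forall a b, N (a + b) <= N a + N b) ->
  (forall (c : R) a, N (c *: a) = `|c| * N a) ->
  0 <= L ->
  (forall x v (r : R), N (F (x + r *: e v) - F x) <= L * `|r|) ->
  (forall i x (r : R), 0 <= r ->
     r * a i <= N (F (x + r *: (\sum_v c i v *: e v)) - F x)) ->
  0 < eps ->
  exists G : W -> B,
    (forall y z b, (forall x, N (F (x + y) - F (x + z)) <= b) ->
       forall x, N (G (x + y) - G (x + z)) <= b) /\
    (forall w : I -> R, (forall i, 0 <= w i) -> forall b,
       (forall x, \sum_i w i * N (\sum_v c i v *: (G (x + e v) - G x)) <= b) ->
       \sum_i w i * (a i - eps) <= b).
Proof.
move=> ND NZ L0 FL Fa eps0.
have e30 : 0 < eps / 3 by lra.
pose m : R := #|V|%:R.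
have m0 : 0 <= m by rewrite ler0n.
pose M := \sum_i \sum_v `|c i v|.
have M0 : 0 <= M by apply: sumr_ge0 => i _; apply: sumr_ge0.
have cM i v : `|c i v| <= M.
  rewrite /M (bigD1 i)//= (bigD1 v)//= -addrA lerDl addr_ge0//.
    exact: sumr_ge0.
  by apply: sumr_ge0 => j _; apply: sumr_ge0.
pose Q := M ^+ 2 * (m ^+ 2 + 2 * m).
(* Each scale depends on the previous one and loses [eps / 3]: [K] absorbs the rounding error of the
   affine approximation, [J] makes second differences negligible over distance [K], and [J'] makes
   segments long compared with the distance from [G] to [F]. *)
have [K [K0 hK]] := exists_nat_mul_ge _ (2 * L * m) _ e30.
have [J [J0 hJ]] := exists_nat_mul_ge _ (2 * L * K%:R * Q) _ e30.
have [J' [J'0 hJ']] := exists_nat_mul_ge _ (2 * (L * J%:R * m)) _ e30.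
have KR : 0 < K%:R :> R by rewrite ltr0n.
have JR : 0 < J%:R :> R by rewrite ltr0n.
pose l := [seq e v | v <- enum V].
have el v : e v \in l by rewrite map_f// mem_enum.
have sl : (size l)%:R = m by rewrite size_map -cardE.
pose G := shift_avg J l F.
have Gconv y z b : (forall x, N (F (x + y) - F (x + z)) <= b) ->
    forall x, N (G (x + y) - G (x + z)) <= b.
  by move=> h x; apply: (shift_avg_Lipschitz ND NZ).
have GL x v r : N (G (x + r *: e v) - G x) <= L * `|r|.
  have := Gconv (r *: e v) 0 (L * `|r|); rewrite /= => /(_ _ x).
  by rewrite addr0; apply=> z; rewrite addr0.
have GF x : N (G x - F x) <= L * J%:R * m.
  rewrite -sl mulr_natr; apply: (shift_avg_dist ND NZ) => // z w r.
  by case/mapP => v _ ->.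
(* The map [z |-> F (z + r *: e u) - F z] is bounded by [L * |r|], so averaging it makes its
   increment along [e v] smaller by a factor of order [J]. *)
have dGL x v u r : N (fwd_diff G (e v) (x + r *: e u) - fwd_diff G (e v) x) <=
    2 * L / J%:R * `|r|.
  have := @shift_avg_diff_small _ _ _ _ ND NZ J l (e v) (fun z => F (z + r *: e u) - F z)
    (L * `|r|) x J0 (el v) (fun z => FL z u r).
  rewrite !shift_avgB !shift_avg_translate -/G => h.
  have -> : fwd_diff G (e v) (x + r *: e u) - fwd_diff G (e v) x =
      G (x + e v + r *: e u) - G (x + e v) - (G (x + r *: e u) - G x).
    by rewrite /fwd_diff (addrAC x) subrACA.
  by rewrite (le_trans h)// mulrA mulrAC.
pose g i x := N (\sum_v c i v *: (G (x + e v) - G x)).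
pose nu i := \sum_v c i v *: e v.
(* At scale [K] both error terms of [linear_approx] are at most [K * (eps / 3)]. *)
have step i x : N (G (x + K%:R *: nu i) - G x) <=
    K%:R * g i x + K%:R * (2 * eps / 3).
  have KM v : `|K%:R * c i v| <= K%:R * M.
    by rewrite normrM ger0_norm ?ler0n// ler_wpM2l ?ler0n.
  have := linear_approx ND NZ _ _ GL dGL (enum V) (fun v => K%:R * c i v) (K%:R * M) x _ KM.
  rewrite !big_enum/=.
  under eq_bigr do rewrite -scalerA.
  under [X in N (_ - _ - X)]eq_bigr do rewrite -scalerA.
  rewrite -!scaler_sumr -/(nu i) -cardE -/m => h.
  have {h} h := h L0 (divr_ge0 (mulr_ge0 (ler0n R 2) L0) (ltW JR)) (mulr_ge0 (ltW KR) M0).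
  rewrite -[X in N X](subrK (K%:R *: (\sum_v c i v *: fwd_diff G (e v) x))).
  rewrite (le_trans (ND _ _))// addrC NZ ger0_norm ?ler0n// lerD//.
  rewrite (le_trans h)//.
  have -> : 2 * L / J%:R * (K%:R * M) ^+ 2 * (m ^+ 2 + 2 * m) =
     K%:R * ((2 * L * K%:R * Q) / J%:R) by rewrite /Q; field; rewrite gt_eqF.
  have h1 : K%:R * ((2 * L * K%:R * Q) / J%:R) <= K%:R * (eps / 3).
    by rewrite ler_wpM2l ?ler0n// ler_pdivrMr.
  lra.
(* A segment of [J'] steps [K *: nu i]: the triangle inequality bounds the increment of [G] above by
   the sum of the steps, while [Fa] and the closeness of [G] to [F] bound it below. *)
have tele i x : a i - eps <= J'%:R^-1 * \sum_(j < J') g i (x + j%:R *: (K%:R *: nu i)).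
  rewrite mulrC ler_pdivlMr ?ltr0n//.
  have h1 : N (G (x + (J'%:R * K%:R) *: nu i) - G x) <=
      K%:R * (\sum_(j < J') g i (x + j%:R *: (K%:R *: nu i))) +
      K%:R * (2 * eps / 3) * J'%:R.
    have -> : G (x + (J'%:R * K%:R) *: nu i) - G x = \sum_(0 <= j < J')
        (G (x + j.+1%:R *: (K%:R *: nu i)) - G (x + j%:R *: (K%:R *: nu i))).
      by rewrite (telescope_sumr (fun j => G (x + j%:R *: (K%:R *: nu i))))// scale0r addr0 scalerA.
    rewrite big_mkord (le_trans (seminorm_sum ND NZ _ _ _ _))//.
    have -> : K%:R * (2 * eps / 3) * J'%:R = \sum_(j < J') (K%:R * (2 * eps / 3)).
      by rewrite sumr_const card_ord mulr_natr.
    rewrite mulr_sumr -big_split/=; apply: ler_sum => j _.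
    by rewrite -natr1 scalerDl scale1r addrA; apply: step.
  have h2 : J'%:R * K%:R * a i <=
      N (G (x + (J'%:R * K%:R) *: nu i) - G x) + 2 * (L * J%:R * m).
    rewrite (le_trans (Fa i x _ _)) ?mulr_ge0 ?ler0n// -/(nu i).
    set y := x + _.
    have -> : F y - F x = (G y - G x) + ((F y - G y) - (F x - G x)).
      by rewrite subrACA [RHS]addrC subrK.
    rewrite (le_trans (ND _ _))// lerD2l (le_trans (seminormB ND NZ _ _))//.
    by rewrite mulr2n mulrDl mul1r; apply: lerD; rewrite (seminormC NZ).
  have K1 : 1 <= K%:R :> R by rewrite ler1n.
  have J'R : 0 < J'%:R :> R by rewrite ltr0n.
  rewrite -(ler_pM2l KR).
  have h3 : eps / 3 * J'%:R <= K%:R * (eps / 3 * J'%:R).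
    by rewrite ler_peMl// mulr_ge0 ?ltW.
  lra.
exists G; split=> // w w0 b hb.
(* One average over a box with all the directions [K *: nu i] serves every [i] at once: [tele]
   applies along the direction belonging to [i]. *)
pose l' := [seq K%:R *: nu i | i <- enum I].
pose Phi x : R^o := \sum_i w i *: (g i x : R^o).
have : \sum_i w i * (a i - eps) <= shift_avg J' l' Phi 0.
  rewrite shift_avg_sum; apply: ler_sum => i _.
  rewrite shift_avgZ; apply: ler_wpM2l => //.
  apply: (@shift_avg_mem_ge _ _ _ _ (K%:R *: nu i)) => //.
    by apply: (map_f (fun i => K%:R *: nu i)); rewrite mem_enum.
  move=> z; rewrite -(mulr_natl (a i - eps)) -ler_pdivlMl ?ltr0n//; exact: tele.
move=> /le_trans; apply; rewrite -[b]opprK lerNr.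
have -> : - shift_avg J' l' Phi 0 = shift_avg J' l' (fun x => - 1 *: Phi x) 0.
  by rewrite shift_avgZ scaleN1r.
apply: shift_avg_ge => // z; rewrite scaleN1r lerN2; exact: hb.
Qed.

(** * The transportation cost norm and the graph distance *)

Section TransportationCost.
Context {R : realType} {V : finType} {d : V -> V -> R}.
Hypothesis d_ge0 : forall u v, 0 <= d u v.
Implicit Types mu : V -> R.

Lemma TC_costs_ge0 mu c : TC_costs d mu c -> 0 <= c.
Proof.
move=> [s [/allP s0 [_ ->]]]; rewrite big_seq; apply: sumr_ge0 => p /s0 p0.
exact: mulr_ge0.
Qed.

(** A function of nonzero total mass has no representation; its norm is then [inf set0], which is
    0. *)
Lemma tc_norm_ge0 mu : 0 <= tc_norm d mu.
Proof.
have [[c hc]|/nonemptyPn h] := pselect (TC_costs d mu !=set0).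
  by apply: lb_le_inf; [exists c|move=> ? /TC_costs_ge0].
by rewrite /tc_norm h inf0.
Qed.

Lemma tc_norm_le mu c : TC_costs d mu c -> tc_norm d mu <= c.
Proof. by apply: ge_inf; exists 0 => ? /TC_costs_ge0. Qed.

Lemma tc_norm_dirac_diff (r : R) u v : 0 <= r ->
  tc_norm d (fun x => r * dirac_diff R u v x) <= r * d u v.
Proof.
move=> r0; apply: tc_norm_le; exists [:: (r, u, v)]; split; first by rewrite /= r0.
by split; [apply/funext => x|]; rewrite big_seq1.
Qed.

Lemma TC_costs_scale (r : R) mu c : 0 <= r -> TC_costs d mu c ->
  TC_costs d (fun x => r * mu x) (r * c).
Proof.
move=> r0 [s [/allP s0 [-> ->]]]; exists [seq (r * p.1.1, p.1.2, p.2) | p <- s].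
split; [|split].
- by apply/allP => _ /mapP[p ps ->] /=; rewrite mulr_ge0// s0.
- apply/funext => x; rewrite big_map mulr_sumr; apply: eq_bigr => p _ /=.
  by rewrite mulrA.
- by rewrite big_map mulr_sumr; apply: eq_bigr => p _ /=; rewrite mulrA.
Qed.

(** Dividing the coefficients of a representation of [r * mu] by [r > 0] represents [mu]. If there
    is none, [mu] has none either and both infima are 0. *)
Lemma tc_norm_scale_ge (r : R) mu : 0 <= r ->
  r * tc_norm d mu <= tc_norm d (fun x => r * mu x).
Proof.
rewrite le_eqVlt => /predU1P[<-|r0]; first by rewrite mul0r tc_norm_ge0.
have rV c : TC_costs d (fun x => r * mu x) c -> TC_costs d mu (r^-1 * c).
  move=> h; have := TC_costs_scale r^-1 _ _ _ h; rewrite invr_ge0 (ltW r0).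
  move=> /(_ isT); congr (TC_costs _ _ _); apply/funext => x.
  by rewrite mulrA mulVf ?gt_eqF// mul1r.
have [[c hc]|/nonemptyPn h] := pselect (TC_costs d (fun x => r * mu x) !=set0).
  apply: lb_le_inf; first by exists c.
  by move=> c' /rV /tc_norm_le; rewrite ler_pdivlMl.
suff h' : TC_costs d mu = set0 by rewrite /tc_norm h h' !inf0 mulr0.
rewrite -subset0 => c hc; have : set0 (r * c) by rewrite -h; apply: TC_costs_scale; rewrite // ltW.
by [].
Qed.

End TransportationCost.

Lemma dG_ge0 (R : realType) (V : finType) (E : {set V * V}) (len : V * V -> R) u v :
  (forall e, e \in E -> 0 < len e) -> 0 <= dG E len u v.
Proof.
move=> len0; rewrite /dG; set S := mkset _.
have S0 L : S L -> 0 <= L.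
  move=> [p [up [_ ->]]] {v S L}; rewrite /path_len; elim: p u up => [|w p IH] u /=.
    by rewrite big_nil.
  move=> /andP[uw /IH h]; rewrite big_cons addr_ge0// /elen /=; case: ifPn => [uwE|uwE].
    by rewrite ltW// len0.
  by rewrite ltW// len0//; move: uw; rewrite /adj (negbTE uwE).
have [[c hc]|/nonemptyPn h] := pselect (S !=set0).
  by apply: lb_le_inf; [exists c|move=> ? /S0].
by rewrite h inf0.
Qed.

(** * The Cauchy-Schwarz and Bessel inequalities *)

Lemma sqr_sum_le (R : realType) (I : finType) (P : pred I) (c : I -> R) :
  (\sum_(i | P i) c i) ^+ 2 <= #|P|%:R * \sum_(i | P i) c i ^+ 2.
Proof.
set m : R := #|P|%:R; set s := \sum_(i | P i) c i.
have [m0|m0] := eqVneq m 0.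
  rewrite m0 mul0r /s big1 ?expr0n// => i Pi; move/eqP: m0.
  by rewrite /m pnatr_eq0 => /eqP /card0_eq /(_ i); rewrite unfold_in Pi.
have mp : 0 < m by rewrite lt0r m0 /m ler0n.
(* Expanding this sum of squares and dividing by [m] gives the claim. *)
have : 0 <= \sum_(i | P i) (m * c i - s) ^+ 2 by apply: sumr_ge0 => i _; apply: sqr_ge0.
under eq_bigr do rewrite sqrrB.
rewrite big_split/= sumrB sumr_const.
have -> : \sum_(i | P i) (m * c i) ^+ 2 = m ^+ 2 * \sum_(i | P i) c i ^+ 2.
  by rewrite mulr_sumr; apply: eq_bigr => i _; rewrite exprMn.
have -> : \sum_(i | P i) m * c i * s *+ 2 = 2 * m * s * s.
  have -> : 2 * m * s * s = \sum_(i | P i) 2 * m * s * c i by rewrite -mulr_sumr.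
  by apply: eq_bigr => i _; ring.
rewrite -mulr_natl -/m => h.
rewrite -(ler_pM2l mp); lra.
Qed.

(** The [theta i] are orthogonal but not normalized, and may vanish; only
    [\sum_t theta i t ^ 2 <= m] enters. Bessel's inequality then reads [S <= m * A], and
    Cauchy-Schwarz over [i] supplies the other factor [m] under the square root. *)
Lemma Bessel_average (R : realType) (M : finType) (P : pred M) (theta : M -> M -> R)
    (a : M -> R) :
  (forall i j, P i -> P j -> i != j -> \sum_(t | P t) theta i t * theta j t = 0) ->
  (forall i t, P i -> P t -> `|theta i t| <= 1) ->
  \sum_(i | P i) `|\sum_(t | P t) theta i t * a t| <=
  #|P|%:R * Num.sqrt (\sum_(t | P t) a t ^+ 2).
Proof.
move=> orth bd; set m : R := #|P|%:R; set A := \sum_(t | P t) a t ^+ 2.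
pose c i := \sum_(t | P t) theta i t * a t.
set S := \sum_(i | P i) c i ^+ 2.
have A0 : 0 <= A by apply: sumr_ge0 => i _; apply: sqr_ge0.
have [m0|m0] := eqVneq m 0.
  rewrite m0 mul0r big1// => i Pi; move/eqP: m0.
  by rewrite /m pnatr_eq0 => /eqP /card0_eq /(_ i); rewrite unfold_in Pi.
have mp : 0 < m by rewrite lt0r m0 /m ler0n.
pose s t := \sum_(i | P i) c i * theta i t.
have as_ : \sum_(t | P t) a t * s t = S.
  under eq_bigr do rewrite mulr_sumr.
  rewrite exchange_big/=; apply: eq_bigr => i _.
  rewrite expr2 [X in _ = _ * X]/c mulr_sumr; apply: eq_bigr => t _; ring.
have ss : \sum_(t | P t) s t ^+ 2 <= m * S.
  have -> : \sum_(t | P t) s t ^+ 2 =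
     \sum_(i | P i) c i ^+ 2 * \sum_(t | P t) theta i t ^+ 2.
    transitivity (\sum_(i | P i) \sum_(j | P j) c i * c j *
                    \sum_(t | P t) theta i t * theta j t).
      under eq_bigr do rewrite expr2 mulr_suml.
      rewrite exchange_big/=; apply: eq_bigr => i _.
      under eq_bigr do rewrite mulr_sumr.
      rewrite exchange_big/=; apply: eq_bigr => j _.
      rewrite mulr_sumr; apply: eq_bigr => t _; ring.
    apply: eq_bigr => i Pi; rewrite (bigD1 i)//= -expr2 [X in _ + X]big1 ?addr0.
      by congr (_ * _); apply: eq_bigr => t _; rewrite expr2.
    by move=> j /andP[Pj ji]; rewrite orth ?mulr0// eq_sym.
  rewrite mulr_sumr; apply: ler_sum => i Pi; rewrite mulrC ler_wpM2r ?sqr_ge0//.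
  have -> : m = \sum_(t | P t) 1 by rewrite sumr_const.
  apply: ler_sum => t Pt; rewrite -real_normK ?num_real//.
  by rewrite expr_le1// bd.
have SA : S <= m * A.
  (* With [as_] and [ss] the expansion is at most [m ^ 2 * A - 2 * m * S + m * S]. *)
  have : 0 <= \sum_(t | P t) (m * a t - s t) ^+ 2 by apply: sumr_ge0 => i _; apply: sqr_ge0.
  under eq_bigr do rewrite sqrrB.
  rewrite big_split/= sumrB.
  have -> : \sum_(i | P i) (m * a i) ^+ 2 = m ^+ 2 * A.
    by rewrite mulr_sumr; apply: eq_bigr => i _; rewrite exprMn.
  have -> : \sum_(i | P i) m * a i * s i *+ 2 = 2 * m * S.
    rewrite -as_ mulr_sumr; apply: eq_bigr => i _; ring.
  move=> h; rewrite -(ler_pM2l mp); lra.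
have m0' := ltW mp.
rewrite -(@ler_pXn2r _ 2)// ?nnegrE ?sumr_ge0 ?mulr_ge0 ?sqrtr_ge0//.
rewrite exprMn sqr_sqrtr// (le_trans (sqr_sum_le _ _ _ _))//.
under eq_bigr do rewrite real_normK ?num_real//.
by rewrite -/S expr2 -mulrA ler_wpM2l.
Qed.

(** * The space of integrable functions *)

Section L1.
Context {R : realType} {d : measure_display} {T : measurableType d}.
Context {m : {measure set T -> \bar R}}.
Local Notation L1 := (LfunType m (lexx (1%E : \bar R))).

(** Elements of [L1] are functions rather than classes, so they can be evaluated at points; the
    price is that this is only a seminorm. *)
Definition L1norm (h : L1) : R := fine ('N[m]_1[EFin \o h])%E.

Lemma L1normD (f g : L1) : L1norm (f + g) <= L1norm f + L1norm g.
Proof. exact: ler_LnormD. Qed.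

Lemma L1normZ (c : R) (f : L1) : L1norm (c *: f) = `|c| * L1norm f.
Proof.
apply/EFin_inj; rewrite EFinM /L1norm !finite_norm_fine; exact: LnormZ.
Qed.

Lemma L1normE (f : L1) : (L1norm f)%:E = (\int[m]_x (`|f x|)%:E)%E.
Proof. by rewrite /L1norm finite_norm_fine Lnorm1. Qed.

Lemma Rintegral_wsum_norm (I : Type) (s : seq I) (P : pred I) (w : I -> R) (h : I -> L1) :
  m.-integrable setT (EFin \o (fun x => \sum_(i <- s | P i) w i * `|h i x|)) /\
  \int[m]_x (\sum_(i <- s | P i) w i * `|h i x|) =
    \sum_(i <- s | P i) w i * L1norm (h i) :> R.
Proof.
have ih i : m.-integrable setT (EFin \o (fun x => `|h i x|)).
  have /Lfun1_integrable := LfunP (h i); exact: integrable_abse.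
have iw i : m.-integrable setT (EFin \o (fun x => w i * `|h i x|)).
  exact: (integrableZl measurableT (w i) (ih i)).
have ihE i : \int[m]_x (w i * `|h i x|) = w i * L1norm (h i) :> R.
  by rewrite RintegralZl// /Rintegral -L1normE.
elim: s => [|i s [IH1 IH2]].
  split.
    by apply: (eq_integrable measurableT (cst 0%E)); [move=> x _ /=; rewrite big_nil|exact: integrable0].
  rewrite big_nil; under eq_Rintegral do rewrite big_nil.
  by rewrite /Rintegral integral0.
case Pi : (P i); last first.
  rewrite big_cons Pi; split.
    by under eq_fun do rewrite big_cons Pi.
  by under eq_Rintegral do rewrite big_cons Pi.
rewrite big_cons Pi -ihE -IH2.
have -> : (fun x => \sum_(j <- i :: s | P j) w j * `|h j x|) =
   (fun x => w i * `|h i x| + \sum_(j <- s | P j) w j * `|h j x|).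
  by apply/funext => x; rewrite big_cons Pi.
split; last by rewrite RintegralD.
exact: (integrableD measurableT (iw i) IH1).
Qed.

(** Serves to integrate (C1), which is available at each point of the measure space, into an
    inequality between norms. *)
Lemma L1norm_wsum_le (I J : Type) (s : seq I) (P : pred I) (r : seq J) (Q : pred J)
    (w : I -> R) (t : J -> R) (h : I -> L1) (g : J -> L1) :
  (forall x, \sum_(i <- s | P i) w i * `|h i x| <= \sum_(j <- r | Q j) t j * `|g j x|) ->
  \sum_(i <- s | P i) w i * L1norm (h i) <= \sum_(j <- r | Q j) t j * L1norm (g j).
Proof.
move=> hg; have [i1 <-] := Rintegral_wsum_norm _ s P w h.
have [i2 <-] := Rintegral_wsum_norm _ r Q t g.
exact: le_Rintegral.
Qed.

Lemma L1_subE (f g : L1) (x : T) :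
  (f - g) x = f x - g x.
Proof. by []. Qed.

Lemma L1_sumE (I : Type) (s : seq I) (c : I -> R) (h : I -> L1) (x : T) :
  (\sum_(i <- s) c i *: h i) x = \sum_(i <- s) c i * h i x.
Proof. by elim: s => [|i s IH]; rewrite ?big_nil// !big_cons -IH. Qed.

End L1.

(** * Averages over the fibres of [kappa] *)

Lemma fiberwise_Bessel_average (R : realType) (K M V : finType) (kappa : M -> K)
    (mu : M -> V -> R) (theta : K -> M -> M -> R) (f : V -> R) :
  (forall k i j, kappa i = k -> kappa j = k -> i != j ->
     \sum_(t : M | kappa t == k) theta k i t * theta k j t = 0) ->
  (forall k i t, kappa i = k -> kappa t = k -> `|theta k i t| <= 1) ->
  \sum_i #|[pred t | kappa t == kappa i]|%:R^-1 *
     `|\sum_v (\sum_(t | kappa t == kappa i) theta (kappa i) i t * mu t v) * f v| <=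
  \sum_k Num.sqrt (\sum_(t | kappa t == k) (\sum_v f v * mu t v) ^+ 2).
Proof.
move=> orth bd; rewrite (partition_big kappa xpredT)//=; apply: ler_sum => k _.
set m := #|[pred t | kappa t == k]|.
have -> : \sum_(i | kappa i == k) #|[pred t | kappa t == kappa i]|%:R^-1 *
     `|\sum_v (\sum_(t | kappa t == kappa i) theta (kappa i) i t * mu t v) * f v| =
  m%:R^-1 * \sum_(i | kappa i == k)
    `|\sum_(t | kappa t == k) theta k i t * (\sum_v f v * mu t v)|.
  rewrite mulr_sumr; apply: eq_bigr => i /eqP ->; congr (_ * `|_|).
  under [RHS]eq_bigr do rewrite mulr_sumr.
  rewrite exchange_big/=; apply: eq_bigr => v _; rewrite mulr_suml.
  by apply: eq_bigr => t _; rewrite -mulrA [mu t v * _]mulrC.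
(* On an empty fibre the weight is the inverse of 0, which is 0. *)
have [m0|m0] := posnP m; first by rewrite m0 invr0 mul0r sqrtr_ge0.
rewrite ler_pdivrMl ?ltr0n//.
apply: (@Bessel_average _ _ [pred t | kappa t == k]).
  by move=> i j /eqP ik /eqP jk ij; apply: orth.
by move=> i t /eqP ik /eqP tk; apply: bd.
Qed.

Lemma sum_fiber_average (R : realType) (K M : finType) (kappa : M -> K) (a : K -> R) :
  (forall k, exists t, kappa t = k) ->
  \sum_i #|[pred t | kappa t == kappa i]|%:R^-1 * a (kappa i) = \sum_k a k.
Proof.
move=> onto; rewrite (partition_big kappa xpredT)//=; apply: eq_bigr => k _.
transitivity (\sum_(i | kappa i == k) #|[pred t | kappa t == k]|%:R^-1 * a k).
  by apply: eq_bigr => i /eqP ->.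
rewrite sumr_const -(mulr_natl (_ * a k)) mulrA mulfV ?mul1r// pnatr_eq0 -lt0n.
by have [t <-] := onto k; apply/card_gt0P; exists t; exact: eqxx.
Qed.

(** * Extension of the embedding to all functions on the vertex set *)

Lemma L1_embedding_lift (R : realType) (X W : Type) (P : set X) (rho : X -> X -> R) (D : R)
    (q : W -> X) : L1_embeds_with P rho D -> (forall x, P (q x)) ->
  exists (d : measure_display) (T : measurableType d) (m : {measure set T -> \bar R})
    (F : W -> LfunType m (lexx (1%E : \bar R))),
    forall x y, rho (q x) (q y) <= L1norm (F x - F y) <= D * rho (q x) (q y).
Proof.
move=> [d [T [m [F [iF hF]]]]] Pq; exists d, T, m.
exists (fun x => Lfun_Sub (lexx _) ((Lfun1_integrable m (F (q x))).2 (iF _ (Pq x)))).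
move=> x y; have [h1 h2] := hF _ _ (Pq x) (Pq y).
by rewrite -!lee_fin L1normE h1 h2.
Qed.

Section Projection.
Context {R : realType} {V : finType} (v0 : V).

(** A linear projection onto the functions of sum 0, putting the missing mass at [v0]. Composed with
    it, the embedding is defined on a whole vector space, where the point masses are available as
    directions. *)
Definition TC_proj (x : V -> R) : V -> R :=
  fun v => x v - (\sum_u x u) * (v == v0)%:R.

Lemma sum_indic (v : V) : \sum_u (u == v)%:R = 1 :> R.
Proof. by rewrite (bigD1 v)//= eqxx big1 ?addr0// => u /negbTE ->. Qed.

Lemma TC_projP x : is_TC (TC_proj x).
Proof. by rewrite /is_TC sumrB -mulr_sumr sum_indic mulr1 subrr. Qed.

Lemma TC_projB x y (v : V) : TC_proj x v - TC_proj y v = TC_proj (x - y) v.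
Proof. by rewrite /TC_proj sumrB !fctE; ring. Qed.

Lemma TC_proj_id x : is_TC x -> TC_proj x = x.
Proof. by move=> h; apply/funext => v; rewrite /TC_proj h mul0r subr0. Qed.

Definition indic_at (v : V) : V -> R := fun u => (u == v)%:R.

Lemma sum_indic_at (c : V -> R) : \sum_v c v *: indic_at v = c.
Proof.
apply/funext => u; rewrite fct_sumE (bigD1 u)//= big1 ?addr0.
  by rewrite /GRing.scale/= /indic_at eqxx /GRing.scale/= mulr1.
by move=> v vu; rewrite /GRing.scale/= /indic_at eq_sym (negbTE vu) /GRing.scale/= mulr0.
Qed.

Lemma TC_proj_indic (r : R) v : TC_proj (r *: indic_at v) = fun u => r * dirac_diff R v v0 u.
Proof.
apply/funext => u; rewrite /TC_proj.
have -> : \sum_w (r *: indic_at v) w = r by rewrite -mulr_sumr sum_indic mulr1.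
by rewrite -mulrBr.
Qed.

Lemma TC_proj_indicB (u v : V) :
  TC_proj (indic_at u - indic_at v) = fun x => 1 * dirac_diff R u v x.
Proof.
rewrite TC_proj_id; first by apply/funext => x; rewrite mul1r.
by rewrite /is_TC sumrB !sum_indic subrr.
Qed.

End Projection.

(** * The lower bound on the distortion *)

Theorem theorem2p1 (R : realType) (V : finType) (E : {set V * V}) (len : V * V -> R)
  (Horient : forall u v, (u, v) \in E -> (u != v) && ((v, u) \notin E))
  (Hconn : forall u v, connect (adj E) u v)
  (Hlen : forall e, e \in E -> 0 < len e)
  (HdG : forall u v, (u, v) \in E -> dG E len u v = len (u, v))
  (n' : nat) (M : finType) (kappa : M -> 'I_n'.+1)
  (HMne : forall k : 'I_n'.+1, exists t : M, kappa t = k)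
  (mu : M -> V -> R) (Hmu : forall t, is_TC (mu t))
  (C : R) (th : V * V -> R)
  (Hth : forall e, e \in E -> 0 < th e)
  (Hthsum : \sum_(e in E) th e * dG E len e.1 e.2 = 1)
  (HC1 : forall f : V -> R,
     \sum_(k < n'.+1) Num.sqrt (\sum_(t : M | kappa t == k) (\sum_(v : V) f v * mu t v) ^+ 2)
       <= C * \sum_(e in E) `|f e.1 - f e.2| * th e)
  (alpha : 'I_n'.+1 -> R) (theta : 'I_n'.+1 -> M -> M -> R)
  (Halpha : forall k, 0 <= alpha k)
  (Horth : forall k i j, kappa i = k -> kappa j = k -> i != j ->
     \sum_(t : M | kappa t == k) theta k i t * theta k j t = 0)
  (Hbd : forall k i t, kappa i = k -> kappa t = k -> `|theta k i t| <= 1)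
  (Hnorm : forall k i, kappa i = k ->
     alpha k <= tc_norm (dG E len) (fun v => \sum_(t : M | kappa t == k) theta k i t * mu t v)) :
  (((\sum_(k < n'.+1) alpha k) / C)%:E <= c1 (@is_TC R V) (tc_dist (dG E len)))%E.
Proof.
apply: le_ereal_inf_tmp => _ [D [D1 emb] <-]; rewrite lee_fin.
have D0 : 0 <= D by apply: le_trans D1.
have sa0 : 0 <= \sum_(k < n'.+1) alpha k by apply: sumr_ge0.
(* For [C <= 0] the quotient is nonpositive, also for [C = 0] since the inverse of 0 is 0. *)
have [C0|C0] := leP C 0.
  by rewrite (le_trans _ D0)// mulr_ge0_le0// invr_le0.
rewrite ler_pdivrMr// mulrC.
have d0 u v : 0 <= dG E len u v by apply: dG_ge0.
(* On an empty vertex set the normalization of [th] would read [0 = 1]. *)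
have [v0 _] : exists v0 : V, True.
  apply: contrapT => noV; have /eqP := Hthsum.
  by rewrite big1 ?(eq_sym 0) ?oner_eq0// => e _; case: noV; exists e.1.
have [dsp [T [m [F hF]]]] := L1_embedding_lift _ _ _ _ _ _ _ emb (TC_projP v0).
pose N := @L1norm R dsp T m.
have FB x y : TC_proj v0 (x - y) = (fun v => TC_proj v0 x v - TC_proj v0 y v).
  by apply/funext => v; rewrite TC_projB.
have Fub x y : N (F x - F y) <= D * tc_norm (dG E len) (TC_proj v0 (x - y)).
  by rewrite FB; have /andP[] := hF x y.
have Flb x y : tc_norm (dG E len) (TC_proj v0 (x - y)) <= N (F x - F y).
  by rewrite FB; have /andP[] := hF x y.
pose L := D * \sum_v (dG E len v v0 + dG E len v0 v).
have L0 : 0 <= L by rewrite mulr_ge0// sumr_ge0// => v _; rewrite addr_ge0.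
have FL x v (r : R) : N (F (x + r *: indic_at v) - F x) <= L * `|r|.
  (* Costs require nonnegative coefficients; a negative [r] is handled by exchanging the two
     endpoints. *)
  wlog r0 : x r / 0 <= r => [h|].
    have [|r0] := leP 0 r; first exact: h.
    have := h (x + r *: indic_at v) (- r); rewrite scaleNr addrK normrN.
    by rewrite /N (seminormC L1normZ); apply; rewrite oppr_ge0 ltW.
  rewrite (le_trans (Fub _ _))// addrAC subrr add0r TC_proj_indic /L -mulrA ler_wpM2l//.
  rewrite (le_trans (tc_norm_dirac_diff d0 _ _ _ r0))// ger0_norm// mulrC ler_wpM2r//.
  rewrite (bigD1 v)//= -addrA lerDl addr_ge0// sumr_ge0// => u _.
  by rewrite addr_ge0.
pose nu i v := \sum_(t : M | kappa t == kappa i) theta (kappa i) i t * mu t v.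
have nuTC i : is_TC (nu i).
  rewrite /is_TC /nu exchange_big/= big1// => t _.
  by rewrite -mulr_sumr Hmu mulr0.
have Fnu i x (r : R) : 0 <= r ->
    r * alpha (kappa i) <= N (F (x + r *: (\sum_v nu i v *: indic_at v)) - F x).
  move=> r0; rewrite sum_indic_at (le_trans _ (Flb _ _))// addrAC subrr add0r.
  rewrite TC_proj_id; last by rewrite /is_TC -mulr_sumr nuTC mulr0.
  rewrite (le_trans _ (tc_norm_scale_ge d0 _ _ r0))// ler_wpM2l//.
  exact: Hnorm.
rewrite leNgt; apply/negP => gap.
(* Each of the [n'.+1] fibres loses [eps], so the total loss is half of the assumed gap. *)
pose eps := (\sum_(k < n'.+1) alpha k - C * D) / (2 * n'.+1%:R).
have n0 : 0 < n'.+1%:R :> R by rewrite ltr0n.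
have eps0 : 0 < eps by rewrite divr_gt0 ?subr_gt0// mulr_gt0.
have [G [Gconv Glow]] := asymptotic_linearization _ _ (@indic_at R V) F L nu
  (fun i => alpha (kappa i)) eps L1normD L1normZ L0 FL Fnu eps0.
pose w i : R := #|[pred t | kappa t == kappa i]|%:R^-1.
have w0 i : 0 <= w i by rewrite invr_ge0 ler0n.
have key : \sum_i w i * (alpha (kappa i) - eps) <= C * D.
  apply: Glow => // x.
  have Gedge (e : V * V) : e \in E ->
      N (G (x + indic_at e.1) - G (x + indic_at e.2)) <= D * dG E len e.1 e.2.
    move=> _; apply: Gconv => z; rewrite (le_trans (Fub _ _))// ler_wpM2l//.
    have := tc_norm_dirac_diff d0 1 e.1 e.2 ler01; rewrite mul1r.
    by rewrite opprD addrACA subrr add0r TC_proj_indicB.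
  have int : \sum_i w i * N (\sum_v nu i v *: (G (x + indic_at v) - G x)) <=
      \sum_(e in E) (C * th e) * N (G (x + indic_at e.1) - G (x + indic_at e.2)).
    apply: L1norm_wsum_le => om.
    under eq_bigr do rewrite L1_sumE.
    under [leRHS]eq_bigr do rewrite L1_subE.
    (* (C1) is applied to the increments of [G] from [x], evaluated at [om]; in differences along
       edges the value at [x] cancels. *)
    have := le_trans (fiberwise_Bessel_average _ _ _ _ _ _ _
      (fun v => G (x + indic_at v) om - G x om) Horth Hbd) (HC1 _).
    rewrite mulr_sumr => /le_trans; apply; apply: ler_sum => e _.
    by rewrite opprB addrA subrK mulrA mulrAC.
  rewrite (le_trans int)//.
  (* The normalization of [th] distributes [C * D] over the edges, to be compared with [Gedge] term
     by term. *)
  have -> : C * D = \sum_(e in E) C * th e * (D * dG E len e.1 e.2).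
    transitivity (C * D * \sum_(e in E) th e * dG E len e.1 e.2).
      by rewrite Hthsum mulr1.
    by rewrite mulr_sumr; apply: eq_bigr => e _; ring.
  apply: ler_sum => e eE; rewrite ler_wpM2l ?Gedge//.
  by rewrite mulr_ge0 ?ltW ?Hth.
have := key; under eq_bigr do rewrite mulrBr.
rewrite sumrB (sum_fiber_average _ _ _ _ alpha HMne).
rewrite (sum_fiber_average _ _ _ kappa (fun=> eps) HMne) sumr_const card_ord -mulr_natr.
have -> : eps * n'.+1%:R = (\sum_(k < n'.+1) alpha k - C * D) / 2.
  by rewrite /eps; field; rewrite gt_eqF.
lra.
Qed.
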